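(* In the setting described in the context, assume in addition that $(A,B)$ is controllable and let $\mathcal{X}_N=\{x\in\mathbb{R}^n:\ \exists\,U=(u_0,\dots,u_{N-1})\in\mathbb{R}^{Nm}$ with $u_k\in\mathcal{U}$ for $k=0,\dots,N-1$, $x_k(U,x)\in\mathcal{X}$ for $k=0,\dots,N-1$, and $x_N(U,x)=0\}$, where $x_k(U,x)=A^kx+\sum_{i=0}^{k-1}A^iBu_{k-1-i}$. Then for every compact set $\mathcal{X}_0\subseteq\mathcal{X}_N^\circ$ (interior of $\mathcal{X}_N$) and every $\hat{z}_{\mathrm{x,tol}}\in\mathbb{R}^{q_{\mathrm{x}}}$, $\hat{z}_{\mathrm{u,tol}}\in\mathbb{R}^{q_{\mathrm{u}}}$ with nonnegative entries, there exist $\bar{\delta}_0>0$ and $\mu\in\mathcal{K}_\infty$ such that for every relaxation parameter $0<\delta\le\bar{\delta}_0$, every $x_0\in\mathcal{X}_0$, every initialization $U_0$ with $\|U_0-\hat{U}^*(x_0)\|\le\mu(\delta)$, every sequence $\boldsymbol{i}_{\mathrm{T}}=\{i_{\mathrm{T}}(0),i_{\mathrm{T}}(1),\dots\}$ of nonnegative integers, and every $k\in\mathbb{N}$, the closed-loop trajectories (constructed with this $\delta$) with $u(k)=\Pi_0U(k)$ satisfy $C_{\mathrm{x}}x(k)\le d_{\mathrm{x}}+\hat{z}_{\mathrm{x,tol}}$ and $C_{\mathrm{u}}u(k)\le d_{\mathrm{u}}+\hat{z}_{\mathrm{u,tol}}$.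
   Context: Let $n,m,N\in\mathbb{N}_+$, $A\in\mathbb{R}^{n\times n}$, $B\in\mathbb{R}^{n\times m}$. Let $\mathcal{X}=\{x\in\mathbb{R}^n: C_{\mathrm{x}}x\le d_{\mathrm{x}}\}$ and $\mathcal{U}=\{u\in\mathbb{R}^m: C_{\mathrm{u}}u\le d_{\mathrm{u}}\}$ be compact polytopes, with $C_{\mathrm{x}}\in\mathbb{R}^{q_{\mathrm{x}}\times n}$, $C_{\mathrm{u}}\in\mathbb{R}^{q_{\mathrm{u}}\times m}$ and $d_{\mathrm{x}},d_{\mathrm{u}}$ having all entries strictly positive; superscript $i$ denotes the $i$-th row/entry, $\mathds{1}$ is the all-ones vector. Fix $\varepsilon>0$, $Q\succeq0$, $R\succ0$ (symmetric), and weight vectors $w_{\mathrm{x}},w_{\mathrm{u}}$ with nonnegative entries satisfying $C_{\mathrm{x}}^\top\mathrm{diag}(1/d_{\mathrm{x}}^1,\dots,1/d_{\mathrm{x}}^{q_{\mathrm{x}}})(\mathds{1}+w_{\mathrm{x}})=0$ and $C_{\mathrm{u}}^\top\mathrm{diag}(1/d_{\mathrm{u}}^1,\dots,1/d_{\mathrm{u}}^{q_{\mathrm{u}}})(\mathds{1}+w_{\mathrm{u}})=0$. For a relaxation parameter $\delta$ with $0<\delta\le$ the smallest entry of $d_{\mathrm{x}}$ and $d_{\mathrm{u}}$, all of the following objects depend on $\delta$. Relaxed barrier: $\hat{B}(z)=-\ln z$ for $z>\delta$, $\hat{B}(z)=\tfrac12[((z-2\delta)/\delta)^2-1]-\ln\delta$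 for $z\le\delta$. Recentered barriers: $\hat{B}_{\mathrm{x}}(x)=\sum_{i=1}^{q_{\mathrm{x}}}(1+w_{\mathrm{x}}^i)(\hat{B}(-C_{\mathrm{x}}^ix+d_{\mathrm{x}}^i)+\ln d_{\mathrm{x}}^i)$, $\hat{B}_{\mathrm{u}}(u)=\sum_{j=1}^{q_{\mathrm{u}}}(1+w_{\mathrm{u}}^j)(\hat{B}(-C_{\mathrm{u}}^ju+d_{\mathrm{u}}^j)+\ln d_{\mathrm{u}}^j)$. Stage cost $\hat{\ell}(x,u)=x^\top Qx+u^\top Ru+\varepsilon\hat{B}_{\mathrm{x}}(x)+\varepsilon\hat{B}_{\mathrm{u}}(u)$. With $M_{\mathrm{x}}=\frac{1}{2\delta^2}C_{\mathrm{x}}^\top\mathrm{diag}(\mathds{1}+w_{\mathrm{x}})C_{\mathrm{x}}$, $M_{\mathrm{u}}=\frac{1}{2\delta^2}C_{\mathrm{u}}^\top\mathrm{diag}(\mathds{1}+w_{\mathrm{u}})C_{\mathrm{u}}$, let $P\succ0$ solve $K=-(R+B^\top PB+\varepsilon M_{\mathrm{u}})^{-1}B^\top PA$, $P=(A+BK)^\top P(A+BK)+K^\top(R+\varepsilon M_{\mathrm{u}})K+Q+\varepsilon M_{\mathrm{x}}$. For $U=(u_0,\dots,u_{N-1})\in\mathbb{R}^{Nm}$, $x\in\mathbb{R}^n$, let $x_0=x$, $x_{k+1}=Ax_k+Bu_k$ and $\hat{J}_N(U,x)=\sum_{k=0}^{N-1}\hat{\ell}(x_k,u_k)+x_N^\top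 Px_N$; $\hat{U}^*(x)=\arg\min_U\hat{J}_N(U,x)$ (unique minimizer). Let $\Pi_0=[I_m\ 0\ \cdots\ 0]$ (so $\Pi_0U=u_0$). Let $k_f:\mathbb{R}^{Nm}\times\mathbb{R}^n\to\mathbb{R}^m$ be a function with $k_f(0,0)=0$ such that for all $(U,x)$, with $x^+=Ax+Bu_0$ and $U^+=(u_1,\dots,u_{N-1},k_f(U,x))$, $\hat{J}_N(U^+,x^+)-\hat{J}_N(U,x)\le-\hat{\ell}(x,u_0)$. Shift operator: $\Psi_{\mathrm{s}}(U,x)=(u_1,\dots,u_{N-1},k_f(U,x))$. Optimizer update operator: any $\Psi_{\mathrm{o}}$ with $\hat{J}_N(\Psi_{\mathrm{o}}(U,x),x)-\hat{J}_N(U,x)\le-\gamma(U,x)$ for all $(U,x)$, where $\gamma\ge0$ and $\gamma(U,x)=0\iff\nabla_U\hat{J}_N(U,x)=0$. Define $\Phi^0(U,x)=\Psi_{\mathrm{s}}(U,x)$, $\Phi^i(U,x)=\Psi_{\mathrm{o}}(\Phi^{i-1}(U,x),Ax+B\Pi_0U)$ for $i\ge1$. Closed loop: $x(k+1)=Ax(k)+B\Pi_0U(k)$, $U(k+1)=\Phi^{i_{\mathrm{T}}(k)}(U(k),x(k))$, $x(0)=x_0$, $U(0)=U_0$. A function $\mu:\mathbb{R}_+\to\mathbb{R}_+$ is in $\mathcal{K}_\infty$ if continuous, strictly increasing, $\mu(0)=0$, and unbounded. *)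

(* Defs.v *)
From HB Require Import structures.
From mathcomp Require Import all_boot all_order all_algebra.
From mathcomp Require Import all_classical all_reals all_analysis.
Set Implicit Arguments. Unset Strict Implicit. Unset Printing Implicit Defensive.
Import Order.TTheory GRing.Theory Num.Theory.
Import numFieldNormedType.Exports.
Local Open Scope classical_set_scope.
Local Open Scope ring_scope.

Section MPC.
Variable R : realType.

Definition lev q (a b : 'cV[R]_q) : Prop := forall i, a i 0 <= b i 0.

Definition enorm p q (M : 'M[R]_(p, q)) : R :=
  Num.sqrt (\sum_i \sum_j M i j ^+ 2).

Definition qform p (M : 'M[R]_p) (x : 'cV[R]_p) : R := (x^T *m M *m x) 0 0.

Definition psd p (M : 'M[R]_p) : Prop :=
  M^T = M /\ forall x : 'cV[R]_p, 0 <= qform M x.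
Definition pd p (M : 'M[R]_p) : Prop :=
  M^T = M /\ forall x : 'cV[R]_p, x != 0 -> 0 < qform M x.

Definition polytope p q (C : 'M[R]_(q, p)) (d : 'cV[R]_q) : set 'cV[R]_p :=
  [set x | lev (C *m x) d].

Definition controllable n m (A : 'M[R]_n) (B : 'M[R]_(n, m)) : Prop :=
  \rank (\mxrow_(k < n) (A ^+ k *m B)) = n.

Definition Kinf (mu : R -> R) : Prop :=
  [/\ {within [set x : R | 0 <= x], continuous mu},
      (forall a b, 0 <= a -> a < b -> mu a < mu b),
      mu 0 = 0 &
      (forall M, exists r, 0 <= r /\ M <= mu r)].

Definition relB (delta z : R) : R :=
  if delta < z then - ln z
  else (((z - 2 * delta) / delta) ^+ 2 - 1) / 2 - ln delta.

Definition recB p q (delta : R) (C : 'M[R]_(q, p)) (d w : 'cV[R]_q)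
  (y : 'cV[R]_p) : R :=
  \sum_(i < q) (1 + w i 0) * (relB delta (d i 0 - (C *m y) i 0) + ln (d i 0)).

Definition weight_cond p q (C : 'M[R]_(q, p)) (d w : 'cV[R]_q) : Prop :=
  C^T *m diag_mx (\row_i (d i 0)^-1) *m (const_mx 1 + w) = 0.

Definition Mmat p q (delta : R) (C : 'M[R]_(q, p)) (w : 'cV[R]_q) : 'M[R]_p :=
  (2 * delta ^+ 2)^-1 *: (C^T *m diag_mx (\row_i (1 + w i 0)) *m C).

Definition ell n m qx qu (eps delta : R) (Q : 'M[R]_n) (Rc : 'M[R]_m)
  (Cx : 'M[R]_(qx, n)) (dx wx : 'cV[R]_qx)
  (Cu : 'M[R]_(qu, m)) (du wu : 'cV[R]_qu) (x : 'cV[R]_n) (u : 'cV[R]_m) : R :=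
  qform Q x + qform Rc u + eps * recB delta Cx dx wx x + eps * recB delta Cu du wu u.

(* the k-th input u_k of U = (u_0, ..., u_{N-1}) (columns of U); 0 if k >= N *)
Definition getu m N (U : 'M[R]_(m, N)) (k : nat) : 'cV[R]_m :=
  \col_i (match @insub nat (fun k => k < N)%N 'I_N k with
          | Some j => U i j | None => 0 end).

Fixpoint traj n m N (A : 'M[R]_n) (B : 'M[R]_(n, m)) (U : 'M[R]_(m, N))
  (x : 'cV[R]_n) (k : nat) : 'cV[R]_n :=
  match k with
  | 0 => x
  | k'.+1 => A *m traj A B U x k' + B *m getu U k'
  end.

Definition JN n m N qx qu (eps delta : R) (A : 'M[R]_n) (B : 'M[R]_(n, m))
  (Q : 'M[R]_n) (Rc : 'M[R]_m) (Cx : 'M[R]_(qx, n)) (dx wx : 'cV[R]_qx)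
  (Cu : 'M[R]_(qu, m)) (du wu : 'cV[R]_qu) (P : 'M[R]_n)
  (U : 'M[R]_(m, N)) (x : 'cV[R]_n) : R :=
  \sum_(k < N) ell eps delta Q Rc Cx dx wx Cu du wu (traj A B U x k) (getu U k)
  + qform P (traj A B U x N).

Definition argmin p q (f : 'M[R]_(p, q) -> R) : 'M[R]_(p, q) :=
  get [set U | forall V, f U <= f V].

Definition XN n m N qx qu (A : 'M[R]_n) (B : 'M[R]_(n, m))
  (Cx : 'M[R]_(qx, n)) (dx : 'cV[R]_qx) (Cu : 'M[R]_(qu, m)) (du : 'cV[R]_qu)
  : set 'cV[R]_n :=
  [set x | exists U : 'M[R]_(m, N),
     [/\ forall k, (k < N)%N -> polytope Cu du (getu U k),
         forall k, (k < N)%N -> polytope Cx dx (traj A B U x k) &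
         traj A B U x N = 0]].

Definition shiftU m N (U : 'M[R]_(m, N)) (v : 'cV[R]_m) : 'M[R]_(m, N) :=
  \matrix_(i, j) (if (j.+1 < N)%N then getu U j.+1 i 0 else v i 0).

Fixpoint Phi n m N (A : 'M[R]_n) (B : 'M[R]_(n, m))
  (kf : 'M[R]_(m, N) -> 'cV[R]_n -> 'cV[R]_m)
  (Psio : 'M[R]_(m, N) -> 'cV[R]_n -> 'M[R]_(m, N))
  (i : nat) (U : 'M[R]_(m, N)) (x : 'cV[R]_n) : 'M[R]_(m, N) :=
  match i with
  | 0 => shiftU U (kf U x)
  | i'.+1 => Psio (Phi A B kf Psio i' U x) (A *m x + B *m getu U 0)
  end.

Fixpoint closed_loop n m N (A : 'M[R]_n) (B : 'M[R]_(n, m))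
  (kf : 'M[R]_(m, N) -> 'cV[R]_n -> 'cV[R]_m)
  (Psio : 'M[R]_(m, N) -> 'cV[R]_n -> 'M[R]_(m, N))
  (iT : nat -> nat) (x0 : 'cV[R]_n) (U0 : 'M[R]_(m, N)) (k : nat)
  : 'cV[R]_n * 'M[R]_(m, N) :=
  match k with
  | 0 => (x0, U0)
  | k'.+1 => let: (x, U) := closed_loop A B kf Psio iT x0 U0 k' in
             (A *m x + B *m getu U 0, Phi A B kf Psio (iT k') U x)
  end.

End MPC.

(* Main.v *)
(** Along the closed loop the relaxed cost never increases, and it dominates
    [eps] times the recentered barrier of the current state and input.  By the
    weight condition the recentered barrier is a sum of nonnegative terms, and
    a violated constraint forces one of them above [ln (d_i / delta)].  Hence
    no constraint is ever violated, even without tolerance, once the initial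
    cost is bounded independently of [delta].

    The optimal initial cost is bounded because, by compactness, [t X0] lies in
    [XN] for some [t > 1]: scaling the inputs back by [1/t] leaves every
    constraint a relative slack [1 - 1/t] and reaches the origin.  The excess
    over the optimum is controlled by second differences: at a minimizer [U],
    [J (U - V) >= J U] gives [J (U + V) - J U <= L (|V| / delta)^2], so a
    linear [mu] suffices.  Here [P] is of order [1 / delta^2], which follows
    from the Riccati equation by comparison with a deadbeat controller. *)

Require Import Defs.
From HB Require Import structures.
From mathcomp Require Import all_boot all_order all_algebra.
From mathcomp Require Import all_classical all_reals all_analysis.
From mathcomp Require Import ring lra.
Set Implicit Arguments.
Unset Strict Implicit.
Unset Printing Implicit Defensive.
Import Order.TTheory GRing.Theory Num.Theory.
Import numFieldNormedType.Exports.
Local Open Scope classical_set_scope.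
Local Open Scope ring_scope.

(** * The relaxed logarithmic barrier *)

Section RelaxedBarrier.
Context {R : realType}.
Implicit Types delta d z h y t : R.

Lemma ln_le_subr1 z : 0 < z -> ln z <= z - 1.
Proof.
move=> z0; have := @le_ln1Dx R (z - 1); rewrite subrKC; apply.
by rewrite ltrBDr addNr.
Qed.

(** Convexity: the left-hand side is the tangent to [- ln] at [d], shifted by [ln d]. On the
    quadratic branch the square is dropped and [(delta - z) / d <= (delta - z) / delta] closes the
    gap. *)
Lemma relB_tangent delta d z : 0 < delta -> delta <= d ->
  1 - z / d <= relB delta z + ln d.
Proof.
move=> de0 ded; have d0 : 0 < d by exact: lt_le_trans ded.
rewrite /relB; case: ltP => [dz|zd].
  have z0 : 0 < z by exact: lt_trans dz.
  have := ln_le_subr1 (divr_gt0 z0 d0); rewrite ln_div ?posrE//; lra.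
have := ln_le_subr1 (divr_gt0 de0 d0); rewrite ln_div ?posrE//.
have -> : (((z - 2 * delta) / delta) ^+ 2 - 1) / 2 =
   1 - z / delta + (z / delta - 1) ^+ 2 / 2 by field; rewrite gt_eqF.
have : 0 <= (z / delta - 1) ^+ 2 by exact: sqr_ge0.
have : (delta - z) / d <= (delta - z) / delta.
  by rewrite ler_wpM2l ?subr_ge0 ?lef_pV2 ?posrE.
rewrite !mulrBl divff ?gt_eqF//; lra.
Qed.

(** The right-hand side is the excess over the tangent at [d]. The quadratic branch contributes
    [- z / delta] twice: one copy absorbs [z / d], the other remains as a penalty growing linearly
    with the violation. *)
Lemma relB_violation delta d z : 0 < delta -> delta <= d -> z < 0 ->
  ln d - ln delta + 1 / 2 - z / delta <= relB delta z + ln d - 1 + z / d.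
Proof.
move=> de0 ded z0; have d0 : 0 < d by exact: lt_le_trans ded.
rewrite /relB ltNge (le_trans (ltW z0) (ltW de0))/=.
have -> : (((z - 2 * delta) / delta) ^+ 2 - 1) / 2 =
   3 / 2 - z / delta *+ 2 + (z / delta) ^+ 2 / 2 by field; rewrite gt_eqF.
have : 0 <= (z / delta) ^+ 2 by exact: sqr_ge0.
have : z / delta <= z / d.
  by rewrite ler_wnM2l ?lef_pV2 ?posrE// ltW.
lra.
Qed.

(** In units of [delta] the barrier is one fixed function up to the constant [- ln delta], which
    makes the curvature estimate scale-free. *)
Lemma relB_scaled delta t : 0 < delta ->
  relB delta (t * delta) = (if 1 < t then - ln t
    else 1 - t + (t - 1) ^+ 2 / 2) - ln delta.
Proof.
move=> de0; have dn0 : delta != 0 by rewrite gt_eqF.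
rewrite /relB -ltr_pdivrMr// divff//; case: ltP => t1.
  by rewrite lnM ?posrE//; [lra | lra].
by congr (_ - _); field.
Qed.

(** The barrier is continuously differentiable with curvature at most [1 / delta ^+ 2]. The constant
    2 exceeds the sharp 1/2, leaving room for elementary bounds when [y] and [z] lie on different
    branches. *)
Lemma relB_upper delta z : 0 < delta ->
  exists s, forall y,
    relB delta y <= relB delta z + s * (y - z) + 2 * ((y - z) / delta) ^+ 2.
Proof.
move=> de0; have dn0 : delta != 0 by rewrite gt_eqF.
have Hsq t : 0 <= t ^+ 2 :> R by exact: sqr_ge0.
have [b ->] : exists b, z = b * delta by exists (z / delta); rewrite divfK.
(* The slope is the derivative at [z = b * delta], namely [- 1 / z] or
   [(z - 2 * delta) / delta ^+ 2]. *)
exists ((if 1 < b then - b^-1 else b - 2) / delta) => y.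
have [a ->] : exists a, y = a * delta by exists (y / delta); rewrite divfK.
rewrite !relB_scaled// -mulrBl mulfK// mulrA [_ / delta * _]mulrAC divfK//.
case: (ltP 1 b) => [b1|b1]; case: (ltP 1 a) => [a1|a1].
- have [a0 b0] : 0 < a /\ 0 < b by split; lra.
  have := ln_le_subr1 (divr_gt0 b0 a0); rewrite ln_div ?posrE//.
  have -> : b / a = 1 + (a - b) ^+ 2 / (a * b) - b^-1 * (a - b).
    by field; rewrite !gt_eqF.
  have : (a - b) ^+ 2 / (a * b) <= (a - b) ^+ 2.
    by rewrite ler_piMr// invf_le1 ?mulr_gt0// mulr_ege1// ltW.
  by move: (Hsq (a - b)); lra.
- have b0 : 0 < b by lra.
  have := ln_le_subr1 b0.
  have : (b - a) * (1 - b^-1) <= (b - a) ^+ 2.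
    rewrite expr2 ler_wpM2l//; first lra.
    have -> : 1 - b^-1 = (b - 1) / b by field; rewrite gt_eqF.
    rewrite ler_pdivrMr//; nra.
  have : b^-1 * b = 1 by rewrite mulVf ?gt_eqF.
  nra.
- have a0 : 0 < a by lra.
  have ai0 : 0 < a^-1 by rewrite invr_gt0.
  have := ln_le_subr1 ai0; rewrite lnV ?posrE//.
  have -> : a^-1 = 2 - a + (a - 1) ^+ 2 / a by field; rewrite gt_eqF.
  have : (a - 1) ^+ 2 / a <= (a - 1) ^+ 2.
    by rewrite ler_piMr// invf_le1// ltW.
  nra.
- by move: (Hsq (a - b)); lra.
Qed.

Lemma relB_second_difference delta z h : 0 < delta ->
  relB delta (z + h) + relB delta (z - h) - 2 * relB delta z
    <= 4 * (h / delta) ^+ 2.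
Proof.
move=> /(@relB_upper _ z)[s Hs]; have := Hs (z + h); have := Hs (z - h).
rewrite (_ : z + h - z = h); last ring.
rewrite (_ : z - h - z = - h); last ring.
by rewrite mulNr sqrrN; lra.
Qed.

(** A branch-free form for the continuity proof: on each side of [delta] one of the two summands is
    frozen at its value at [delta]. *)
Lemma relB_max_min delta z : 0 < delta ->
  relB delta z = - ln (Num.max delta z)
    + (((Num.min delta z - 2 * delta) / delta) ^+ 2 - 1) / 2.
Proof.
move=> de0; rewrite /relB; case: ltP => [dz|zd]; last by rewrite addrC.
rewrite (_ : (delta - 2 * delta) / delta = -1); last by field; rewrite gt_eqF.
by rewrite sqrrN expr1n subrr mul0r addr0.
Qed.

Lemma continuous_relB delta : 0 < delta -> continuous (relB delta).
Proof.
move=> de0.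
rewrite (_ : relB delta = fun z => - ln (Num.max delta z)
  + (((Num.min delta z - 2 * delta) / delta) ^+ 2 - 1) / 2); last first.
  by apply/funext => z; exact: relB_max_min.
move=> z; apply: cvgD.
  apply: cvgN; apply: continuous_comp.
    by apply: (@continuous_max _ _ (fun=> delta) id); [exact: cst_continuous|exact: id].
  by apply: continuous_ln; rewrite lt_max de0.
apply: cvgMl; apply: cvgB; last exact: cvg_cst.
apply: cvgM; apply: cvgMl; apply: cvgB; try exact: cvg_cst.
  by apply: (@continuous_min _ _ (fun=> delta) id); [exact: cst_continuous|exact: id].
by apply: (@continuous_min _ _ (fun=> delta) id); [exact: cst_continuous|exact: id].
Qed.
End RelaxedBarrier.

(** * Matrix and quadratic-form estimates in the entrywise maximum norm *)

Section MatrixNorm.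
Context {R : realType}.

Lemma coord_le_norm p q (M : 'M[R]_(p, q)) i j : `|M i j| <= `|M|.
Proof.
by rewrite [leRHS]/Num.norm/= mx_normrE; apply/bigmax_geP; right; exists (i, j).
Qed.

Lemma norm_le_coord p q (M : 'M[R]_(p, q)) c : 0 <= c ->
  (forall i j, `|M i j| <= c) -> `|M| <= c.
Proof.
move=> c0 H; rewrite [leLHS]/Num.norm/= mx_normrE.
by apply/bigmax_leP; split => // -[i j].
Qed.

Lemma norm_mulmx p q r (M : 'M[R]_(p, q)) (V : 'M[R]_(q, r)) :
  `|M *m V| <= q%:R * `|M| * `|V|.
Proof.
apply: norm_le_coord => [|i j]; first by rewrite !mulr_ge0.
rewrite mxE (le_trans (ler_norm_sum _ _ _))// -mulrA mulr_natl.
rewrite -[X in _ *+ X]card_ord -sumr_const; apply: ler_sum => k _.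
by rewrite normrM ler_pM// coord_le_norm.
Qed.

(** Transfers the Euclidean bound on the initialization to the maximum norm in which all estimates
    are made. *)
Lemma norm_le_enorm p q (M : 'M[R]_(p, q)) : `|M| <= enorm M.
Proof.
apply: norm_le_coord => [|i j]; first exact: sqrtr_ge0.
rewrite -sqrtr_sqr ler_wsqrtr// (bigD1 i)//= (bigD1 j)//=.
rewrite -addrA lerDl addr_ge0 ?sumr_ge0// => k _; rewrite ?sumr_ge0// => *;
  exact: sqr_ge0.
Qed.

Lemma qform_le_norm p (M : 'M[R]_p) (x : 'cV[R]_p) :
  `|qform M x| <= p%:R ^+ 2 * `|M| * `|x| ^+ 2.
Proof.
rewrite (le_trans (coord_le_norm _ _ _))// (le_trans (norm_mulmx _ _))//.
rewrite (_ : _ ^+ 2 * _ * _ ^+ 2 = p%:R * (p%:R * `|x| * `|M|) * `|x|);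
  last by ring.
rewrite ler_wpM2r// ler_wpM2l// (le_trans (norm_mulmx _ _))//.
rewrite ler_wpM2r// ler_wpM2l// norm_le_coord// => i j.
by rewrite mxE coord_le_norm.
Qed.

(** The parallelogram law, through which quadratic terms enter the second differences. *)
Lemma qformD p (M : 'M[R]_p) (x y : 'cV[R]_p) :
  qform M (x + y) + qform M (x - y) = 2 * qform M x + 2 * qform M y.
Proof.
rewrite /qform !(linearD, linearN)/= !(mulmxDl, mulmxDr, mulmxN, mulNmx, opprD, opprK).
have D (M1 M2 : 'M[R]_1) : (M1 + M2) 0 0 = M1 0 0 + M2 0 0 by rewrite mxE.
have N (M1 : 'M[R]_1) : (- M1) 0 0 = - M1 0 0 by rewrite mxE.
by rewrite !(D, N); ring.
Qed.

Lemma qform0 p (M : 'M[R]_p) : qform M 0 = 0.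
Proof. by rewrite /qform mulmx0 mxE. Qed.

Lemma pd_psd p (M : 'M[R]_p) : pd M -> psd M.
Proof.
move=> [MT Mp]; split=> // x.
by have [->|/Mp/ltW//] := eqVneq x 0; rewrite qform0.
Qed.

Lemma mulmx_continuous {T : topologicalType} p q r (M : 'M[R]_(p, q))
    (f : T -> 'M[R]_(q, r)) :
  (forall i j, continuous (fun t => f t i j)) ->
  forall i j, continuous (fun t => (M *m f t) i j).
Proof.
move=> cf i j t; rewrite /continuous_at; under eq_cvg do rewrite mxE; rewrite mxE.
by apply: cvg_big => [|k _]; [exact: add_continuous | apply: cvgMr; exact: cf].
Qed.

Lemma qform_continuous {T : topologicalType} p (M : 'M[R]_p)
    (f : T -> 'cV[R]_p) :
  (forall i j, continuous (fun t => f t i j)) ->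
  continuous (fun t => qform M (f t)).
Proof.
move=> cf t; rewrite /continuous_at /qform; under eq_cvg do rewrite -mulmxA mxE.
rewrite -mulmxA mxE.
apply: cvg_big => [|k _]; first exact: add_continuous.
under eq_cvg do rewrite mxE; rewrite mxE.
by apply: cvgM; [exact: cf | exact: mulmx_continuous].
Qed.

End MatrixNorm.

(** * The recentered barrier of a polytope *)

Section RecenteredBarrier.
Context {R : realType} {p q : nat}.
Variables (C : 'M[R]_(q, p)) (d w : 'cV[R]_q) (delta : R).
Hypotheses (w0 : forall i, 0 <= w i 0) (de0 : 0 < delta).
Implicit Types x y : 'cV[R]_p.

Lemma recB_second_difference x y :
  recB delta C d w (x + y) + recB delta C d w (x - y) - 2 * recB delta C d w x
  <= \sum_i (1 + w i 0) * (4 * ((C *m y) i 0 / delta) ^+ 2).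
Proof.
rewrite /recB mulr_sumr -sumrN -!big_split/=; apply: ler_sum => i _.
have D (M1 M2 : 'cV[R]_q) : (M1 + M2) i 0 = M1 i 0 + M2 i 0 by rewrite mxE.
have N (M1 : 'cV[R]_q) : (- M1) i 0 = - M1 i 0 by rewrite mxE.
rewrite mulmxDr mulmxBr !(D, N).
have := relB_second_difference (d i 0 - (C *m x) i 0) ((C *m y) i 0) de0.
rewrite opprB opprD addrA => H.
have := ler_wpM2l (addr_ge0 ler01 (w0 i)) H.
rewrite (_ : d i 0 + ((C *m y) i 0 - (C *m x) i 0) =
  d i 0 - (C *m x) i 0 + (C *m y) i 0); last by ring.
by lra.
Qed.

(** A slack of at least [eta * d i 0], itself above [delta], keeps every summand on the logarithmic
    branch, so the bound is free of [delta]. *)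
Lemma recB_interior_le eta x : 0 < eta ->
  (forall i, 0 < d i 0) -> (forall i, delta < eta * d i 0) ->
  (forall i, eta * d i 0 <= d i 0 - (C *m x) i 0) ->
  recB delta C d w x <= (\sum_i (1 + w i 0)) * - ln eta.
Proof.
move=> e0 d0 ded Hx; rewrite /recB mulr_suml; apply: ler_sum => i _.
rewrite ler_wpM2l ?addr_ge0// /relB (lt_le_trans (ded i) (Hx i)).
have z0 : 0 < eta * d i 0 by rewrite mulr_gt0.
have : ln (eta * d i 0) <= ln (d i 0 - (C *m x) i 0).
  by rewrite ler_ln ?posrE// (lt_le_trans z0).
by rewrite lnM ?posrE//; lra.
Qed.

Hypotheses (ded : forall i, delta <= d i 0) (wC : weight_cond C d w).

(* The weight condition makes the tangents of the summands at the origin add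
   up to zero, so that [recB] is a sum of nonnegative excesses over tangents. *)
Lemma recB_excess x : recB delta C d w x =
  \sum_i (1 + w i 0) * (relB delta (d i 0 - (C *m x) i 0) + ln (d i 0)
                        - 1 + (d i 0 - (C *m x) i 0) / d i 0).
Proof.
apply/eqP; rewrite eq_sym -subr_eq0 -sumrB; apply/eqP.
have /matrixP/(_ 0 0) : - (x^T *m (C^T *m diag_mx (\row_i (d i 0)^-1)
    *m (const_mx 1 + w))) = 0 by rewrite wC mulmx0 oppr0.
rewrite !mulmxA -trmx_mul mul_mx_diag ![in X in X -> _]mxE -sumrN => E; rewrite -[RHS]E.
apply: eq_bigr => i _; rewrite !mxE.
have := lt_le_trans de0 (ded i); set z := \sum_j _ => di0.
by field; rewrite gt_eqF.
Qed.

Let excess_ge0 x i : 0 <= (1 + w i 0) *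
  (relB delta (d i 0 - (C *m x) i 0) + ln (d i 0)
                        - 1 + (d i 0 - (C *m x) i 0) / d i 0).
Proof.
apply: mulr_ge0; first by rewrite addr_ge0.
by have := relB_tangent (d i 0 - (C *m x) i 0) de0 (ded i); lra.
Qed.

Lemma recB_ge0 x : 0 <= recB delta C d w x.
Proof. by rewrite recB_excess sumr_ge0. Qed.

(** The other excesses are nonnegative and the weight [1 + w i 0] is at least 1, so the violated
    constraint alone bounds the whole sum from below. *)
Lemma recB_violation x i : d i 0 < (C *m x) i 0 ->
  ln (d i 0) - ln delta + 1 / 2 + ((C *m x) i 0 - d i 0) / delta
    <= recB delta C d w x.
Proof.
move=> vi; rewrite recB_excess (bigD1 i)//=.
have s0 : 0 <= \sum_(j < q | j != i) (1 + w j 0) *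
  (relB delta (d j 0 - (C *m x) j 0) + ln (d j 0)
                        - 1 + (d j 0 - (C *m x) j 0) / d j 0) by exact: sumr_ge0.
have z0 : d i 0 - (C *m x) i 0 < 0 by rewrite subr_lt0.
have := relB_violation de0 (ded i) z0; rewrite -mulNr opprB => H.
apply: le_trans H _; rewrite -[leLHS]addr0 lerD// ler_peMl ?lerDl//.
by have := relB_tangent (d i 0 - (C *m x) i 0) de0 (ded i); lra.
Qed.

Lemma recB_continuous {T : topologicalType} (f : T -> 'cV[R]_p) :
  (forall i, continuous (fun t => f t i 0)) ->
  continuous (fun t => recB delta C d w (f t)).
Proof.
move=> cf; rewrite /recB; apply: continuous_big; first exact: add_continuous.
move=> i _ t; apply: cvgMr; apply: cvgD; last exact: cvg_cst.
apply: (@continuous_comp _ _ _ (fun t => d i 0 - (C *m f t) i 0) (relB delta));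
  last exact: continuous_relB.
apply: cvgB; first exact: cvg_cst.
under eq_cvg do rewrite mxE; rewrite mxE.
apply: cvg_big => [|j _]; first exact: add_continuous.
by apply: cvgMr; exact: cf.
Qed.

End RecenteredBarrier.

(** Homogeneity: [t^-1 *: y] lies in the polytope, so one radius serves all dilations. Feasible
    points use [t = 1]; coercivity of the cost uses larger [t]. *)
Lemma polytope_scaled_bounded {R : realType} p q (C : 'M[R]_(q, p)) (d : 'cV[R]_q) :
  compact (polytope C d) ->
  exists2 c, 0 <= c & forall t, 0 < t -> forall y : 'cV[R]_p,
    (forall i, (C *m y) i 0 <= t * d i 0) -> `|y| <= t * c.
Proof.
move=> /compact_bounded[c [_ Hc]]; exists (`|c| + 1); first by rewrite addr_ge0.
move=> t t0 y Hy.
have /Hc : c < `|c| + 1 by rewrite (le_lt_trans (ler_norm c))// ltrDl.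
move=> /(_ (t^-1 *: y)) /=.
rewrite normrZ gtr0_norm ?invr_gt0// mulrC ler_pdivrMr// mulrC; apply.
by move=> i; rewrite -scalemxAr mxE mulrC ler_pdivrMr// mulrC.
Qed.

(** * Positive definite weights and their growth in [1 / delta] *)

Section QuadraticForm.
Context {R : realType}.

Lemma qform_mulmx p q (M : 'M[R]_p) (L : 'M[R]_(p, q)) (x : 'cV[R]_q) :
  qform M (L *m x) = qform (L^T *m M *m L) x.
Proof. by rewrite /qform trmx_mul !mulmxA. Qed.

Lemma qformDm p (M1 M2 : 'M[R]_p) (x : 'cV[R]_p) :
  qform (M1 + M2) x = qform M1 x + qform M2 x.
Proof. by rewrite /qform mulmxDr mulmxDl mxE. Qed.

Lemma qformZm p c (M : 'M[R]_p) (x : 'cV[R]_p) :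
  qform (c *: M) x = c * qform M x.
Proof. by rewrite /qform -scalemxAr -scalemxAl mxE. Qed.

Lemma qform_sqrD p (M : 'M[R]_p) (x y : 'cV[R]_p) : M^T = M ->
  qform M (x + y) = qform M x + 2 * (y^T *m M *m x) 0 0 + qform M y.
Proof.
move=> MT; rewrite /qform [(x + y)^T]linearD/= !(mulmxDl, mulmxDr).
have E : (x^T *m M *m y) 0 0 = (y^T *m M *m x) 0 0.
  transitivity ((x^T *m M *m y)^T 0 0); first by rewrite [RHS]mxE.
  by rewrite !trmx_mul trmxK MT mulmxA.
have D (M1 M2 : 'M[R]_1) : (M1 + M2) 0 0 = M1 0 0 + M2 0 0 by rewrite mxE.
by rewrite !D E; ring.
Qed.

Lemma qform_diag p (e : 'rV[R]_p) (x : 'cV[R]_p) :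
  qform (diag_mx e) x = \sum_i e 0 i * x i 0 ^+ 2.
Proof.
rewrite /qform mul_mx_diag mxE; apply: eq_bigr => i _.
by rewrite !mxE expr2; ring.
Qed.

Lemma psdD p (M1 M2 : 'M[R]_p) : psd M1 -> psd M2 -> psd (M1 + M2).
Proof.
move=> [T1 p1] [T2 p2]; split=> [|x]; first by rewrite linearD/= T1 T2.
by rewrite qformDm addr_ge0.
Qed.

Lemma psdZ p c (M : 'M[R]_p) : 0 <= c -> psd M -> psd (c *: M).
Proof.
move=> c0 [T1 p1]; split=> [|x]; first by rewrite linearZ/= T1.
by rewrite qformZm mulr_ge0.
Qed.

Lemma psd_congr p q (M : 'M[R]_p) (L : 'M[R]_(p, q)) :
  psd M -> psd (L^T *m M *m L).
Proof.
move=> [T1 p1]; split=> [|x]; last by rewrite -qform_mulmx.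
by rewrite !trmx_mul trmxK T1 mulmxA.
Qed.

Lemma pdD p (M1 M2 : 'M[R]_p) : pd M1 -> psd M2 -> pd (M1 + M2).
Proof.
move=> [T1 p1] [T2 p2]; split=> [|x x0]; first by rewrite linearD/= T1 T2.
by rewrite qformDm ltr_wpDr// p1.
Qed.

(** A nonzero row [v] in the left kernel would make the form vanish at [v^T]. *)
Lemma pd_unitmx p (M : 'M[R]_p) : pd M -> M \in unitmx.
Proof.
move=> [_ Mp]; rewrite -row_free_unit -kermx_eq0 -nz_row_eq0.
apply/negPn/negP => /[dup] v0; set v := nz_row _ => _.
have vM : v *m M = 0 by apply/sub_kermxP; exact: nz_row_sub.
have /Mp : v^T != 0 by rewrite -(inj_eq trmx_inj) trmxK trmx0.
by rewrite /qform trmxK vM mul0mx mxE ltxx.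
Qed.

Lemma psd_Mmat p q delta (C : 'M[R]_(q, p)) (w : 'cV[R]_q) :
  (forall i, 0 <= w i 0) -> psd (Mmat delta C w).
Proof.
move=> w0; apply: psdZ; first by rewrite invr_ge0 mulr_ge0 ?sqr_ge0.
apply: psd_congr; split=> [|x]; first exact: tr_diag_mx.
rewrite qform_diag sumr_ge0// => i _; rewrite mxE mulr_ge0 ?sqr_ge0//.
by rewrite addr_ge0.
Qed.

Lemma qform_le_scaled p (M : 'M[R]_p) delta (x : 'cV[R]_p) :
  0 < delta -> delta <= 1 ->
  qform M x <= p%:R ^+ 2 * `|M| * (`|x| / delta) ^+ 2.
Proof.
move=> de0 de1; apply: (le_trans (ler_norm _)).
apply: le_trans (qform_le_norm _ _) _; apply: ler_wpM2l.
  by rewrite mulr_ge0 ?sqr_ge0.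
rewrite ler_sqr ?nnegrE ?divr_ge0 ?(ltW de0)// ler_peMr//.
by rewrite invf_ge1.
Qed.

(** The constant is fixed before [delta]: the barrier weight depends on [delta] only through its
    prefactor, and [delta <= 1] lets the fixed weight [M] share the same scale. *)
Lemma relaxed_weight_le p q eps (M : 'M[R]_p) (C : 'M[R]_(q, p))
    (w : 'cV[R]_q) : 0 <= eps ->
  exists2 c, 0 <= c & forall delta, 0 < delta -> delta <= 1 ->
    forall x, qform (M + eps *: Mmat delta C w) x <= c * (`|x| / delta) ^+ 2.
Proof.
move=> e0; set M1 := C^T *m diag_mx (\row_i (1 + w i 0)) *m C.
exists (p%:R ^+ 2 * `|M| + eps * (p%:R ^+ 2 * `|M1|)) => [|delta de0 de1 x].
  by rewrite addr_ge0 ?mulr_ge0 ?sqr_ge0.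
rewrite qformDm !qformZm [leRHS]mulrDl lerD ?qform_le_scaled// -mulrA ler_wpM2l//.
apply: (@le_trans _ _ ((delta ^+ 2)^-1 * `|qform M1 x|)).
  apply: le_trans (ler_wpM2l _ (ler_norm _)) _.
    by rewrite invr_ge0 mulr_ge0 ?sqr_ge0.
  rewrite ler_wpM2r// lef_pV2 ?posrE ?mulr_gt0 ?exprn_gt0//.
  by rewrite ler_peMl ?sqr_ge0// ler1n.
rewrite mulrC ler_pdivrMr ?exprn_gt0// (le_trans (qform_le_norm _ _))//.
by rewrite -[leRHS]mulrA ler_wpM2l ?mulr_ge0 ?sqr_ge0// expr_div_n divfK
  ?expf_neq0 ?gt_eqF.
Qed.

End QuadraticForm.

(** * The Riccati equation and the size of [P] *)

Section Riccati.
Context {R : realType} {n m : nat}.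
Variables (A : 'M[R]_n) (B : 'M[R]_(n, m)).

(* Dynamic-programming inequality: completing the square in [u - K x]. *)
Lemma riccati_step_le (P W : 'M[R]_n) (S : 'M[R]_m) (K : 'M[R]_(m, n)) x u :
  psd P -> psd S -> (S + B^T *m P *m B) *m K = - (B^T *m P *m A) ->
  P = (A + B *m K)^T *m P *m (A + B *m K) + K^T *m S *m K + W ->
  qform P x <= qform P (A *m x + B *m u) + qform S u + qform W x.
Proof.
move=> [PT P0] [ST S0] HK DARE.
have [v uE] : exists v, u = K *m x + v by exists (u - K *m x); rewrite addrC subrK.
have -> : A *m x + B *m u = (A + B *m K) *m x + B *m v.
  by rewrite uE mulmxDr mulmxDl addrA mulmxA.
rewrite [X in qform S X]uE !qform_sqrD//.
rewrite [in leLHS]DARE !qformDm -!qform_mulmx.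
suff -> : ((B *m v)^T *m P *m ((A + B *m K) *m x)) 0 0 =
    - (v^T *m S *m (K *m x)) 0 0.
  have := P0 (B *m v); have := S0 v. lra.
apply/eqP; rewrite -addr_eq0; apply/eqP.
transitivity ((v^T *m (B^T *m P *m A + (S + B^T *m P *m B) *m K) *m x) 0 0).
  rewrite trmx_mul !(mulmxDr, mulmxDl) !mulmxA.
  have D (M1 M2 : 'M[R]_1) : (M1 + M2) 0 0 = M1 0 0 + M2 0 0 by rewrite mxE.
  by rewrite !D; ring.
by rewrite HK subrr mulmx0 mul0mx mxE.
Qed.

(** Inputs steering every state to the origin in [n] steps: from initial state [x], [F k *m x] is
    the input and [G k *m x] the state at time [k]. Full rank of the controllability matrix makes it
    right invertible, so some [D] is mapped by it to [- A ^+ n]. *)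
Lemma deadbeat : controllable A B -> exists (F : nat -> 'M[R]_(m, n))
    (G : nat -> 'M[R]_n),
  [/\ G 0 = 1%:M, forall k, G k.+1 = A *m G k + B *m F k & G n = 0].
Proof.
rewrite /controllable => rk.
have /row_freeP[Gi GGi] : row_free (\mxrow_(k < n) (A ^+ k *m B)).
  by rewrite /row_free rk.
pose D := - (Gi *m A ^+ n).
(* The input at time [j] acts on the state at time [n] through [A ^+ (n - j.+1)], so the blocks of
   [D] are read in reverse order; only [j < n] matters. *)
pose F (j : nat) := if insub (n - j.+1)%N is Some k then submxcol D k else 0.
pose G := fix G k := if k is k'.+1 then A *m G k' + B *m F k' else 1%:M.
exists F, G; split=> //.
have GE k : G k = A ^+ k + \sum_(j < k) A ^+ (k - j.+1) *m B *m F j.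
  elim: k => [|k IH]; first by rewrite big_ord0 addr0.
  rewrite /= IH mulmxDr exprS -addrA; congr (_ + _).
  rewrite big_ord_recr/= subnn expr0 mul1mx mulmx_sumr; congr (_ + _).
  apply: eq_bigr => j _; rewrite subSS !mulmxA mulmxE -exprS.
  by rewrite -subSn.
rewrite GE (reindex_inj rev_ord_inj)/=.
rewrite (eq_bigr (fun k : 'I_n => (A ^+ k *m B) *m submxcol D k)); last first.
  move=> k _; rewrite subnSK// subKn 1?ltnW//; congr (_ *m _).
  by rewrite /F subnSK// subKn ?valK// ltnW.
rewrite -mul_mxrow_mxcol submxcolK mulmxN mulmxA GGi mul1mx.
exact: subrr.
Qed.

(** Unrolling the dynamic-programming inequality along the deadbeat inputs bounds the form of [P] by
    [n] stage weights of order [1 / delta ^+ 2]; the terminal term vanishes, so [c] depends on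
    neither [delta] nor [P]. *)
Lemma riccati_bound qx qu eps (Q : 'M[R]_n) (Rc : 'M[R]_m)
  (Cx : 'M[R]_(qx, n)) (wx : 'cV[R]_qx)
  (Cu : 'M[R]_(qu, m)) (wu : 'cV[R]_qu) :
  0 < eps -> pd Rc ->
  (forall j, 0 <= wu j 0) ->
  controllable A B ->
  exists2 c, 0 <= c & forall delta P, 0 < delta -> delta <= 1 -> pd P ->
    let Mx := Mmat delta Cx wx in
    let Mu := Mmat delta Cu wu in
    let K := - (invmx (Rc + (B^T *m P *m B) + eps *: Mu)
                   *m (B^T *m P *m A)) in
    P = (A + B *m K)^T *m P *m (A + B *m K)
                   + K^T *m (Rc + eps *: Mu) *m K + Q + eps *: Mx ->
    forall x, qform P x <= c * (`|x| / delta) ^+ 2.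
Proof.
move=> e0 pdR wu0 /deadbeat[F [G [G0 GS Gn]]].
have [cW cW0 HW] := relaxed_weight_le Q Cx wx (ltW e0).
have [cS cS0 HS] := relaxed_weight_le Rc Cu wu (ltW e0).
exists (\sum_(k < n) (cW * (n%:R * `|G k|) ^+ 2 + cS * (n%:R * `|F k|) ^+ 2)).
  by rewrite sumr_ge0// => k _; rewrite addr_ge0// mulr_ge0// sqr_ge0.
move=> delta P de0 de1 pdP Mx Mu K DARE x.
have psdS : psd (Rc + eps *: Mu).
  by apply: psdD; [exact: pd_psd|apply: psdZ; [exact: ltW|exact: psd_Mmat]].
have step k : qform P (G k *m x) <= qform P (G k.+1 *m x)
    + qform (Rc + eps *: Mu) (F k *m x) + qform (Q + eps *: Mx) (G k *m x).
  rewrite GS mulmxDl -!mulmxA.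
  apply: (@riccati_step_le _ _ _ K) => //; first exact: pd_psd.
    (* Positive definiteness makes the matrix inverted in [K] a unit, which yields the linear
       equation for [K] in [riccati_step_le]. *)
    rewrite mulmxN mulmxA addrAC mulmxV ?mul1mx//.
    apply: pd_unitmx; rewrite -addrA; apply: pdD => //; apply: psdD.
      by apply: psd_congr; exact: pd_psd.
    by apply: psdZ; [exact: ltW|exact: psd_Mmat].
  by rewrite addrA.
have tele k : qform P x <= qform P (G k *m x) + \sum_(j < k)
    (qform (Q + eps *: Mx) (G j *m x) + qform (Rc + eps *: Mu) (F j *m x)).
  elim: k => [|k IH]; first by rewrite G0 mul1mx big_ord0 addr0.
  by rewrite big_ord_recr/=; move: (step k) IH; lra.
apply: le_trans (tele n) _; rewrite Gn mul0mx qform0 add0r mulr_suml.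
apply: ler_sum => k _; rewrite mulrDl; apply: lerD.
  apply: le_trans (HW _ de0 de1 _) _; rewrite -mulrA ler_wpM2l// -exprMn.
  rewrite ler_sqr ?nnegrE ?mulr_ge0 ?invr_ge0 ?(ltW de0)//.
  by rewrite mulrA ler_wpM2r ?invr_ge0 ?(ltW de0)// norm_mulmx.
apply: le_trans (HS _ de0 de1 _) _; rewrite -mulrA ler_wpM2l// -exprMn.
rewrite ler_sqr ?nnegrE ?mulr_ge0 ?invr_ge0 ?(ltW de0)//.
by rewrite mulrA ler_wpM2r ?invr_ge0 ?(ltW de0)// norm_mulmx.
Qed.

End Riccati.

(** * Linearity, bounds and continuity of predicted trajectories *)

Section Trajectories.
Context {R : realType} {n m N : nat}.
Variables (A : 'M[R]_n) (B : 'M[R]_(n, m)).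
Implicit Types (U V : 'M[R]_(m, N)) (x y : 'cV[R]_n).

Lemma getu_linear a U V k : getu (a *: U + V) k = a *: getu U k + getu V k.
Proof.
apply/colP => i; rewrite !mxE; case: insubP => [j _ _|_]; rewrite ?mxE//.
by rewrite mulr0 addr0.
Qed.

Lemma traj_linear a U V x y k :
  traj A B (a *: U + V) (a *: x + y) k = a *: traj A B U x k + traj A B V y k.
Proof.
elim: k => //= k ->; rewrite getu_linear !mulmxDr -!scalemxAr scalerDr.
by rewrite addrACA.
Qed.

Lemma getuZ a U k : getu (a *: U) k = a *: getu U k.
Proof.
apply/colP => i; rewrite !mxE; case: insubP => [j _ _|_]; rewrite ?mxE//.
by rewrite mulr0.
Qed.

Lemma trajZ a U x k : traj A B (a *: U) (a *: x) k = a *: traj A B U x k.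
Proof.
by elim: k => //= k ->; rewrite getuZ -!scalemxAr scalerDr.
Qed.

Lemma getu_norm V k : `|getu V k| <= `|V|.
Proof.
apply: norm_le_coord => // i j; rewrite mxE; case: insubP => [l _ _|_].
  exact: coord_le_norm.
by rewrite normr0.
Qed.

(** The response to an input perturbation alone, hence the zero initial state; one constant covers
    all times up to [K]. *)
Lemma traj_norm K : exists2 c, 0 <= c &
  forall k V, (k <= K)%N -> `|traj A B V 0 k| <= c * `|V|.
Proof.
elim: K => [|K [c c0 IH]].
  by exists 0 => // -[|//] V _; rewrite /= normr0 mul0r.
exists (c + (n%:R * `|A| * c + m%:R * `|B|)).
  by rewrite !addr_ge0 ?mulr_ge0.
move=> k V; rewrite leq_eqVlt ltnS => /predU1P[->/=|/IH kV]; last first.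
  by rewrite mulrDl (le_trans (kV V))// lerDl mulr_ge0 ?addr_ge0 ?mulr_ge0.
rewrite (le_trans (ler_normD _ _))// !mulrDl.
apply: ler_wpDl; first by rewrite mulr_ge0.
apply: lerD.
  by rewrite (le_trans (norm_mulmx _ _))// -[leRHS]mulrA ler_wpM2l ?mulr_ge0// IH.
by rewrite (le_trans (norm_mulmx _ _))// ler_wpM2l ?mulr_ge0// getu_norm.
Qed.

Lemma getu_continuous {T : topologicalType} (f : T -> 'M[R]_(m, N)) k i :
  (forall i j, continuous (fun t => f t i j)) ->
  continuous (fun t => getu (f t) k i 0).
Proof.
move=> cf t; rewrite /continuous_at; under eq_cvg do rewrite mxE; rewrite mxE.
by case: insubP => [j _ _|_]; [exact: cf | exact: cvg_cst].
Qed.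

Lemma traj_continuous {T : topologicalType} (f : T -> 'M[R]_(m, N)) x k i j :
  (forall i j, continuous (fun t => f t i j)) ->
  continuous (fun t => traj A B (f t) x k i j).
Proof.
move=> cf; elim: k i j => [|k IH] i j t /=; first exact: cvg_cst.
rewrite /continuous_at; under eq_cvg do rewrite mxE; rewrite mxE.
apply: cvgD.
  exact: (@mulmx_continuous _ _ _ _ _ A (fun t => traj A B (f t) x k)).
apply: (@mulmx_continuous _ _ _ _ _ B (fun t => getu (f t) k)) => {}i {}j.
by rewrite ord1; exact: getu_continuous.
Qed.

End Trajectories.

(** * The cost: second differences, lower bounds and existence of minimizers *)

Lemma recB_second_difference_le {R : realType} p q (C : 'M[R]_(q, p))
    (d w : 'cV[R]_q) delta (x y : 'cV[R]_p) :
  (forall i, 0 <= w i 0) -> 0 < delta ->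
  recB delta C d w (x + y) + recB delta C d w (x - y) - 2 * recB delta C d w x
  <= (\sum_i (1 + w i 0) * (4 * (p%:R * `|C|) ^+ 2)) * (`|y| / delta) ^+ 2.
Proof.
move=> w0 de0; apply: le_trans (recB_second_difference C d w0 de0 x y) _.
rewrite mulr_suml; apply: ler_sum => i _.
rewrite -[leRHS]mulrA ler_wpM2l ?addr_ge0// -[leRHS]mulrA ler_wpM2l//.
rewrite -real_normK ?num_real// -exprMn ler_sqr ?nnegrE ?mulr_ge0 ?invr_ge0 ?(ltW de0)//.
rewrite normrM [ `|delta^-1|]gtr0_norm ?invr_gt0// !mulrA.
rewrite ler_wpM2r ?invr_ge0 ?(ltW de0)//.
by rewrite (le_trans (coord_le_norm _ _ _))// norm_mulmx.
Qed.

Section Cost.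
Context {R : realType} {n m N qx qu : nat}.
Variables (A : 'M[R]_n) (B : 'M[R]_(n, m))
  (Cx : 'M[R]_(qx, n)) (dx : 'cV[R]_qx) (Cu : 'M[R]_(qu, m)) (du : 'cV[R]_qu)
  (eps : R) (Q : 'M[R]_n) (Rc : 'M[R]_m) (wx : 'cV[R]_qx) (wu : 'cV[R]_qu).
Hypotheses (e0 : 0 < eps)
  (wx0 : forall i, 0 <= wx i 0) (wu0 : forall j, 0 <= wu j 0).
Implicit Types (U V : 'M[R]_(m, N)) (x y : 'cV[R]_n) (u v : 'cV[R]_m).

Notation l delta := (ell eps delta Q Rc Cx dx wx Cu du wu).
Notation J delta P := (JN eps delta A B Q Rc Cx dx wx Cu du wu P).

(** A common radius [r] puts state and input perturbations on one scale, ready for summation over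
    the stages. *)
Lemma ell_second_difference_le : exists2 c, 0 <= c &
  forall delta, 0 < delta -> delta <= 1 -> forall x y u v r,
  `|y| <= r -> `|v| <= r ->
  l delta (x + y) (u + v) + l delta (x - y) (u - v) - 2 * l delta x u
    <= c * (r / delta) ^+ 2.
Proof.
exists (2 * (n%:R ^+ 2 * `|Q|) + 2 * (m%:R ^+ 2 * `|Rc|)
  + eps * (\sum_i (1 + wx i 0) * (4 * (n%:R * `|Cx|) ^+ 2))
  + eps * (\sum_i (1 + wu i 0) * (4 * (m%:R * `|Cu|) ^+ 2))).
  rewrite !addr_ge0// ?mulr_ge0 ?sqr_ge0 ?(ltW e0)// sumr_ge0// => i _;
  by rewrite ?mulr_ge0 ?sqr_ge0 ?addr_ge0.
move=> delta de0 de1 x y u v r yr vr.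
have sc (s : R) : 0 <= s -> s <= r -> (s / delta) ^+ 2 <= (r / delta) ^+ 2.
  move=> s0 sr; rewrite ler_sqr ?nnegrE ?divr_ge0 ?(ltW de0)//.
    by rewrite ler_wpM2r ?invr_ge0 ?(ltW de0).
  exact: le_trans sr.
have /sc /(_ yr) ysc := normr_ge0 y; have /sc /(_ vr) vsc := normr_ge0 v.
apply: (@le_trans _ _ (2 * qform Q y + 2 * qform Rc v +
  eps * (recB delta Cx dx wx (x + y) + recB delta Cx dx wx (x - y)
    - 2 * recB delta Cx dx wx x) +
  eps * (recB delta Cu du wu (u + v) + recB delta Cu du wu (u - v)
    - 2 * recB delta Cu du wu u))).
  by rewrite /ell; have := qformD Q x y; have := qformD Rc u v; lra.
rewrite [leRHS]mulrDl; apply: lerD;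
  [rewrite [leRHS]mulrDl; apply: lerD; [rewrite [leRHS]mulrDl; apply: lerD|]|].
- rewrite -[leRHS]mulrA ler_wpM2l// (le_trans (qform_le_scaled _ _ de0 de1))//.
  by rewrite ler_wpM2l// mulr_ge0 ?sqr_ge0.
- rewrite -[leRHS]mulrA ler_wpM2l// (le_trans (qform_le_scaled _ _ de0 de1))//.
  by rewrite ler_wpM2l// mulr_ge0 ?sqr_ge0.
- rewrite -[leRHS]mulrA ler_wpM2l ?(ltW e0)//.
  apply: le_trans (recB_second_difference_le _ _ _ _ wx0 de0) _.
  rewrite ler_wpM2l ?sumr_ge0// => i _.
  by rewrite ?mulr_ge0 ?sqr_ge0 ?addr_ge0.
- rewrite -[leRHS]mulrA ler_wpM2l ?(ltW e0)//.
  apply: le_trans (recB_second_difference_le _ _ _ _ wu0 de0) _.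
  rewrite ler_wpM2l ?sumr_ge0// => i _.
  by rewrite ?mulr_ge0 ?sqr_ge0 ?addr_ge0.
Qed.

(** By linearity, [U + V] and [U - V] displace the trajectory of [U] by plus and minus the response
    to [V] from the origin, so every stage and the terminal term is a symmetric second
    difference. *)
Lemma JN_second_difference_le cP : 0 <= cP -> exists2 L, 0 <= L &
  forall delta P, 0 < delta -> delta <= 1 ->
  (forall x, qform P x <= cP * (`|x| / delta) ^+ 2) ->
  forall x U V, J delta P (U + V) x + J delta P (U - V) x - 2 * J delta P U x
    <= L * (`|V| / delta) ^+ 2.
Proof.
move=> cP0; have [cl cl0 Hl] := ell_second_difference_le.
have [cT cT0 HT] := @traj_norm _ _ _ N A B N.
(* Adding 1 to [cT] lets a single factor bound both the state response and the inputs of [V]. *)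
exists (\sum_(k < N) cl * (cT + 1) ^+ 2 + 2 * (cP * (cT + 1) ^+ 2)).
  apply: addr_ge0; last by do 2 rewrite mulr_ge0 ?sqr_ge0//.
  by apply: sumr_ge0 => k _; rewrite mulr_ge0 ?sqr_ge0.
move=> delta P de0 de1 HP x U V.
have trV k : (k <= N)%N -> `|traj A B V 0 k| <= (cT + 1) * `|V|.
  by move=> kN; rewrite (le_trans (HT _ _ kN))// ler_wpM2r// lerDl.
have trD k : traj A B (U + V) x k = traj A B U x k + traj A B V 0 k.
  have := traj_linear A B 1 U V x 0 k; rewrite !scale1r addr0//.
have trB k : traj A B (U - V) x k = traj A B U x k - traj A B V 0 k.
  have := traj_linear A B (-1) V U 0 x k.
  by rewrite scaler0 add0r !scaleN1r ![- _ + _]addrC.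
have guD k : getu (U + V) k = getu U k + getu V k.
  by have := getu_linear 1 U V k; rewrite !scale1r.
have guB k : getu (U - V) k = getu U k - getu V k.
  by have := getu_linear (-1) V U k; rewrite !scaleN1r ![- _ + _]addrC.
rewrite /JN !trD !trB.
have := qformD P (traj A B U x N) (traj A B V 0 N).
have : qform P (traj A B V 0 N) <= cP * (cT + 1) ^+ 2 * (`|V| / delta) ^+ 2.
  rewrite (le_trans (HP _))// -mulrA ler_wpM2l// -exprMn.
  rewrite ler_sqr ?nnegrE ?divr_ge0 ?mulr_ge0 ?addr_ge0 ?invr_ge0 ?(ltW de0)//.
  by rewrite mulrA ler_wpM2r ?invr_ge0 ?(ltW de0)// trV.
suff : \sum_(k < N) l delta (traj A B (U + V) x k) (getu (U + V) k)
  + \sum_(k < N) l delta (traj A B (U - V) x k) (getu (U - V) k)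
  - 2 * \sum_(k < N) l delta (traj A B U x k) (getu U k)
  <= (\sum_(k < N) cl * (cT + 1) ^+ 2) * (`|V| / delta) ^+ 2 by lra.
rewrite mulr_sumr -sumrN -!big_split/= mulr_suml; apply: ler_sum => k _.
rewrite trD trB guD guB -[leRHS]mulrA -exprMn [(cT + 1) * _]mulrA.
apply: Hl => //.
  by rewrite trV// ltnW.
by rewrite (le_trans (getu_norm _ _))// ler_peMl// lerDr.
Qed.

Hypotheses (Q0 : psd Q) (R0 : pd Rc)
  (wCx : weight_cond Cx dx wx) (wCu : weight_cond Cu du wu).

Section FixedRelaxation.
Variables (delta : R) (P : 'M[R]_n).
Hypotheses (de0 : 0 < delta) (dedx : forall i, delta <= dx i 0)
  (dedu : forall j, delta <= du j 0) (P0 : pd P).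

Lemma ell_ge_recB x u :
  eps * recB delta Cx dx wx x + eps * recB delta Cu du wu u <= l delta x u.
Proof.
rewrite /ell -addrA lerDr addr_ge0//; first by case: Q0.
by have [_] := pd_psd R0.
Qed.

Lemma ell_ge_recBx x u : eps * recB delta Cx dx wx x <= l delta x u.
Proof.
rewrite (le_trans _ (ell_ge_recB _ _))// lerDl mulr_ge0 ?(ltW e0)//.
exact: recB_ge0.
Qed.

Lemma ell_ge_recBu x u : eps * recB delta Cu du wu u <= l delta x u.
Proof.
rewrite (le_trans _ (ell_ge_recB _ _))// lerDr mulr_ge0 ?(ltW e0)//.
exact: recB_ge0.
Qed.

Lemma ell_ge0 x u : 0 <= l delta x u.
Proof.
rewrite (le_trans _ (ell_ge_recBx _ _))// mulr_ge0 ?(ltW e0)//.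
exact: recB_ge0.
Qed.

Lemma JN_ge_ell U x k : (k < N)%N ->
  l delta (traj A B U x k) (getu U k) <= J delta P U x.
Proof.
move=> kN; rewrite /JN (bigD1 (Ordinal kN))//= -addrA lerDl addr_ge0//.
  by rewrite sumr_ge0// => *; exact: ell_ge0.
by have [_] := pd_psd P0.
Qed.

Lemma JN_ge0 U x : 0 <= J delta P U x.
Proof.
rewrite /JN addr_ge0//; last by have [_] := pd_psd P0.
by rewrite sumr_ge0// => *; exact: ell_ge0.
Qed.

Lemma JN_continuous {T : topologicalType} (f : T -> 'M[R]_(m, N)) x :
  (forall i j, continuous (fun t => f t i j)) ->
  continuous (fun t => J delta P (f t) x).
Proof.
move=> cf.
have ct k i j : continuous (fun t => traj A B (f t) x k i j).
  exact: traj_continuous.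
have cu k i j : continuous (fun t => getu (f t) k i j).
  by rewrite ord1; exact: getu_continuous.
move=> t; rewrite /continuous_at /JN.
apply: cvgD; last exact: (qform_continuous (ct N)).
apply: cvg_big => [|k _]; first exact: add_continuous.
apply: cvgD; [apply: cvgD; [apply: cvgD|apply: cvgMr]|apply: cvgMr].
- exact: (qform_continuous (ct k)).
- exact: (qform_continuous (cu k)).
- exact: (recB_continuous de0 (fun i => ct k i 0)).
- exact: (recB_continuous de0 (fun i => cu k i 0)).
Qed.

(* Coercivity comes from the input barrier: on a sublevel set every input lies
   in a dilation of the compact polytope. *)
Lemma JN_minimizer x : compact (polytope Cu du) ->
  exists U, forall V, J delta P U x <= J delta P V x.
Proof.
move=> /polytope_scaled_bounded[c c0 Hc].
(* [b] bounds the barrier of each input on the sublevel set of the zero sequence; an input outside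
   the dilation by [1 + b] would have a larger barrier. *)
pose b := J delta P (0 : 'M[R]_(m, N)) x / eps.
have b0 : 0 <= b by rewrite divr_ge0 ?(ltW e0)// JN_ge0.
have coercive (V : 'M[R]_(m, N)) :
    J delta P V x <= J delta P (0 : 'M[R]_(m, N)) x -> `|mxvec V| <= (1 + b) * c.
  move=> JV; apply: norm_le_coord => [|i0 k].
    by rewrite mulr_ge0 ?addr_ge0.
  rewrite ord1 => {i0}; case/mxvec_indexP: k => i j; rewrite mxvecE.
  have -> : V i j = getu V j i 0 by rewrite mxE valK.
  rewrite (le_trans (coord_le_norm _ _ _))//; apply: Hc.
    by rewrite ltr_wpDr.
  move=> k; rewrite leNgt; apply/negP => viol.
  have dk : du k 0 < (Cu *m getu V j) k 0.
    apply: le_lt_trans viol; rewrite mulrDl mul1r lerDl mulr_ge0//.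
    exact: le_trans (ltW de0) (dedu k).
  have := recB_violation wu0 de0 dedu wCu dk.
  have : recB delta Cu du wu (getu V j) <= b.
    rewrite ler_pdivlMr// mulrC (le_trans _ JV)//.
    by rewrite (le_trans _ (JN_ge_ell V x (ltn_ord j)))// ell_ge_recBu.
  have : b < ((Cu *m getu V j) k 0 - du k 0) / delta.
    rewrite ltr_pdivlMr// ltrBrDl (le_lt_trans _ viol)//.
    by rewrite mulrDl mul1r lerD2l ler_wpM2l.
  have : ln delta <= ln (du k 0).
    by rewrite ler_ln ?posrE// (lt_le_trans de0).
  by lra.
pose S : set 'rV[R]_(m * N) := [set v | `|v| <= (1 + b) * c].
have cS : compact S.
  apply: bounded_closed_compact.
    exists ((1 + b) * c); split; first exact: num_real.
    by move=> M cM v /= vS; rewrite (le_trans vS)// ltW.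
  apply: (@closed_comp _ _ (fun v : 'rV[R]_(m * N) => `|v|) [set t | t <= _]).
    by move=> v _; exact: norm_continuous.
  exact: closed_le.
have S0 : S 0 by rewrite /S/= normr0 mulr_ge0 ?addr_ge0.
have cv i j : continuous (fun v : 'rV[R]_(m * N) => vec_mx v i j).
  by move=> v; rewrite /continuous_at; under eq_cvg do rewrite mxE;
    rewrite mxE; exact: coord_continuous.
have [r _ vmin] := @compact_EVT_min _ R
  (fun r : 'rV[R]_(m * N) => J delta P (vec_mx r) x) S
  (ex_intro _ 0 S0) cS (continuous_subspaceT (JN_continuous cv)).
exists (vec_mx r) => V.
(* Outside the sublevel set the cost exceeds that of the zero sequence, which belongs to [S]. *)
have [JV|JV] := leP (J delta P V x) (J delta P (0 : 'M[R]_(m, N)) x).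
  have := vmin (mxvec V); rewrite mxvecK; apply.
  by rewrite inE; exact: coercive.
apply: (le_trans _ (ltW JV)); have := vmin 0; rewrite linear0; apply.
by rewrite inE.
Qed.

End FixedRelaxation.

End Cost.

(** The reciprocal of [1 + \sum_i (d i 0)^-1] stands in for the smallest entry; the added 1 keeps it
    positive for an empty vector. *)
Lemma exists_pos_lower_bound {R : realType} q (d : 'cV[R]_q) :
  (forall i, 0 < d i 0) -> exists2 c, 0 < c & forall i, c <= d i 0.
Proof.
move=> d0; have di0 i : 0 <= (d i 0)^-1 by rewrite invr_ge0 ltW.
have s0 : 0 < 1 + \sum_i (d i 0)^-1 by rewrite ltr_pwDl// sumr_ge0.
exists (1 + \sum_i (d i 0)^-1)^-1 => [|i]; first by rewrite invr_gt0.
rewrite invf_ple ?posrE//; apply: ler_wpDl => //.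
by rewrite (bigD1 i)//= lerDl sumr_ge0.
Qed.

(** * Feasible inputs of uniformly bounded cost *)

Section Feasibility.
Context {R : realType} {n m N qx qu : nat}.
Variables (A : 'M[R]_n) (B : 'M[R]_(n, m))
  (Cx : 'M[R]_(qx, n)) (dx : 'cV[R]_qx) (Cu : 'M[R]_(qu, m)) (du : 'cV[R]_qu)
  (eps : R) (Q : 'M[R]_n) (Rc : 'M[R]_m) (wx : 'cV[R]_qx) (wu : 'cV[R]_qu).

(** Scaling is continuous at [t = 1], and compactness makes the admissible neighbourhood of 1
    uniform over [X0]. *)
Lemma compact_interior_dilation (E X0 : set 'cV[R]_n) :
  compact X0 -> X0 `<=` interior E ->
  exists2 t : R, 1 < t & forall x, X0 x -> E (t *: x).
Proof.
move=> /compact_near_coveringP cX0 X0E.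
have /nbhs_ballP[r /= r0 Hr] :
    \forall t \near (1 : R), X0 `<=` (fun x => E (t *: x)).
  apply: (cX0 R (nbhs (1 : R)) (fun t x => E (t *: x)) _) => x /X0E Ex.
  have := @scale_continuous R 'cV[R]_n (1, x) E.
  rewrite /= scale1r => /(_ Ex) [[V1 V2] /= [n1 n2] H].
  by exists (V2, V1) => // -[y t] [Vy Vt]; exact: (H (t, y)).
exists (1 + r / 2); first by rewrite ltrDl divr_gt0.
move=> x X0x; apply: (Hr (1 + r / 2)) => //.
rewrite /ball/= opprD addNKr normrN gtr0_norm ?divr_gt0//.
by rewrite ltr_pdivrMr// ltr_pMr// ltr1n.
Qed.

(** The scaled candidate still ends at the origin, so the terminal cost drops out; this is why [b]
    can be chosen before [delta] and [P]. *)
Lemma JN_feasible_le (X0 : set 'cV[R]_n) :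
  compact (polytope Cx dx) -> compact (polytope Cu du) ->
  (forall i, 0 < dx i 0) -> (forall j, 0 < du j 0) -> 0 < eps ->
  (forall i, 0 <= wx i 0) -> (forall j, 0 <= wu j 0) ->
  compact X0 -> X0 `<=` interior (XN N A B Cx dx Cu du) ->
  exists eta b, [/\ 0 < eta, eta <= 1, 0 <= b &
  forall delta P, 0 < delta -> (forall i, delta < eta * dx i 0) ->
    (forall j, delta < eta * du j 0) -> forall x, X0 x ->
  exists U : 'M[R]_(m, N),
    JN eps delta A B Q Rc Cx dx wx Cu du wu P U x <= b].
Proof.
move=> /polytope_scaled_bounded[bx bx0 Hbx] /polytope_scaled_bounded[bu bu0 Hbu].
move=> dx0 du0 e0 wx0 wu0 cX0 X0N.
have [t t1 Ht] := compact_interior_dilation cX0 X0N.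
have t0 : 0 < t by exact: lt_trans t1.
have ti1 : t^-1 < 1 by rewrite invf_lt1.
have ti0 : 0 < t^-1 by rewrite invr_gt0.
pose eta := 1 - t^-1.
have eta0 : 0 < eta by rewrite subr_gt0.
have eta1 : eta <= 1 by rewrite lerBlDr lerDl ltW.
have lneta : 0 <= - ln eta by rewrite oppr_ge0 ln_le0.
pose bl := n%:R ^+ 2 * `|Q| * bx ^+ 2 + m%:R ^+ 2 * `|Rc| * bu ^+ 2
  + eps * ((\sum_i (1 + wx i 0)) * - ln eta)
  + eps * ((\sum_i (1 + wu i 0)) * - ln eta).
exists eta, (\sum_(k < N) bl); split=> //.
  apply: sumr_ge0 => k _.
  by rewrite !addr_ge0// !mulr_ge0 ?sqr_ge0 ?(ltW e0)// sumr_ge0// => i _;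
    rewrite addr_ge0.
move=> delta P de0 dedx dedu x /Ht[U [HU Hx HN]].
exists (t^-1 *: U).
have trE k : traj A B (t^-1 *: U) x k = t^-1 *: traj A B U (t *: x) k.
  by rewrite -trajZ scalerA mulVf ?scale1r// gt_eqF.
rewrite /JN trE HN scaler0 qform0 addr0; apply: ler_sum => k _.
(* Shrinking a feasible point by [t^-1] leaves the fraction [eta = 1 - t^-1] of each [d i 0] as
   slack. *)
have shrink p q (C : 'M[R]_(q, p)) (d : 'cV[R]_q) (y : 'cV[R]_p) i :
    polytope C d y -> eta * d i 0 <= d i 0 - (C *m (t^-1 *: y)) i 0.
  move=> /(_ i) yi; rewrite -scalemxAr.
  have -> : (t^-1 *: (C *m y)) i 0 = t^-1 * (C *m y) i 0 by rewrite mxE.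
  rewrite mulrBl mul1r.
  by rewrite lerD2l lerN2 ler_wpM2l// ltW.
rewrite trE getuZ /ell.
have Qle p (M : 'M[R]_p) (y : 'cV[R]_p) b :
    `|y| <= b -> qform M (t^-1 *: y) <= p%:R ^+ 2 * `|M| * b ^+ 2.
  move=> yb; rewrite (le_trans (ler_norm _))// (le_trans (qform_le_norm _ _))//.
  have b0 : 0 <= b by exact: le_trans yb.
  rewrite ler_wpM2l ?mulr_ge0 ?sqr_ge0// ler_sqr ?nnegrE//.
  by rewrite normrZ gtr0_norm// (le_trans _ yb)// ler_piMl// ltW.
have kN := ltn_ord k.
apply: lerD; [apply: lerD; [apply: lerD|]|].
- by apply: Qle; rewrite -[bx]mul1r; apply: Hbx => // i; rewrite mul1r; exact: Hx.
- by apply: Qle; rewrite -[bu]mul1r; apply: Hbu => // i; rewrite mul1r; exact: HU.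
- rewrite ler_wpM2l ?(ltW e0)//; apply: recB_interior_le => // i.
  by apply: shrink; exact: Hx.
- rewrite ler_wpM2l ?(ltW e0)//; apply: recB_interior_le => // i.
  by apply: shrink; exact: HU.
Qed.

End Feasibility.

(** Comparing [U] with [U - V] makes the second-difference bound one-sided, in place of the
    first-order optimality condition. *)
Lemma minimizer_perturbation {R : realType} p q (f : 'M[R]_(p, q) -> R) b U V :
  (forall W, f U <= f W) -> f (U + V) + f (U - V) - 2 * f U <= b ->
  f (U + V) <= f U + b.
Proof. by move=> /(_ (U - V)); lra. Qed.


(** * Choice of the constants and cost decrease along the closed loop *)

Theorem theorem3 (R : realType) (n m N qx qu : nat)
  (A : 'M[R]_n) (B : 'M[R]_(n, m))
  (Cx : 'M[R]_(qx, n)) (dx : 'cV[R]_qx) (Cu : 'M[R]_(qu, m)) (du : 'cV[R]_qu)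
  (eps : R) (Q : 'M[R]_n) (Rc : 'M[R]_m) (wx : 'cV[R]_qx) (wu : 'cV[R]_qu)
  (P : R -> 'M[R]_n)
  (kf : R -> 'M[R]_(m, N) -> 'cV[R]_n -> 'cV[R]_m)
  (Psio : R -> 'M[R]_(m, N) -> 'cV[R]_n -> 'M[R]_(m, N))
  (gamma : R -> 'M[R]_(m, N) -> 'cV[R]_n -> R) :
  (0 < n)%N -> (0 < m)%N -> (0 < N)%N ->
  compact (polytope Cx dx) -> compact (polytope Cu du) ->
  (forall i, 0 < dx i 0) -> (forall j, 0 < du j 0) ->
  0 < eps -> psd Q -> pd Rc ->
  (forall i, 0 <= wx i 0) -> (forall j, 0 <= wu j 0) ->
  weight_cond Cx dx wx -> weight_cond Cu du wu ->
  (* the objects depending on the relaxation parameter delta *)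
  (forall delta, 0 < delta -> (forall i, delta <= dx i 0) ->
     (forall j, delta <= du j 0) ->
     let Mx := Mmat delta Cx wx in
     let Mu := Mmat delta Cu wu in
     let K := - (invmx (Rc + (B^T *m P delta *m B) + eps *: Mu)
                   *m (B^T *m P delta *m A)) in
     let J := JN eps delta A B Q Rc Cx dx wx Cu du wu (P delta) in
     let l := ell eps delta Q Rc Cx dx wx Cu du wu in
     pd (P delta) /\
         P delta = (A + B *m K)^T *m P delta *m (A + B *m K)
                   + K^T *m (Rc + eps *: Mu) *m K + Q + eps *: Mx /\
         kf delta 0 0 = 0 /\
         (forall U x, J (shiftU U (kf delta U x)) (A *m x + B *m getu U 0)
                      - J U x <= - l x (getu U 0)) /\
         (forall U x, J (Psio delta U x) x - J U x <= - gamma delta U x) /\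
         (forall U x, 0 <= gamma delta U x) /\
         (forall U x, gamma delta U x = 0 <->
            forall i j, 'D_(delta_mx i j) (fun V => J V x) U = 0)) ->
  controllable A B ->
  forall X0 : set 'cV[R]_n,
  compact X0 -> X0 `<=` interior (XN N A B Cx dx Cu du) ->
  forall (zxtol : 'cV[R]_qx) (zutol : 'cV[R]_qu),
  (forall i, 0 <= zxtol i 0) -> (forall j, 0 <= zutol j 0) ->
  exists delta0 : R, exists mu : R -> R,
    0 < delta0 /\ Kinf mu /\
    forall delta, 0 < delta -> delta <= delta0 ->
    forall x0, X0 x0 ->
    forall U0 : 'M[R]_(m, N),
      enorm (U0 - argmin (fun U => JN eps delta A B Q Rc Cx dx wx Cu du wu
                                     (P delta) U x0)) <= mu delta ->
    forall (iT : nat -> nat) (k : nat),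
      let xU := closed_loop A B (kf delta) (Psio delta) iT x0 U0 k in
      lev (Cx *m xU.1) (dx + zxtol) /\ lev (Cu *m getu xU.2 0) (du + zutol).
Proof.
move=> n0 m0 N0 cX cU dx0 du0 e0 psdQ pdR wx0 wu0 wCx wCu Hdelta ctrl X0 cX0 X0N.
move=> zx zu zx0 zu0.
have [cP cP0 HP] := riccati_bound Q Cx wx Cu e0 pdR wu0 ctrl.
have [L L0 HL] := JN_second_difference_le (N := N) A B Cx dx Cu du Q Rc e0 wx0 wu0 cP0.
have [eta [b [eta0 eta1 b0 Hfeas]]] :=
  JN_feasible_le Q Rc cX cU dx0 du0 e0 wx0 wu0 cX0 X0N.
have [cx cx0 Hcx] := exists_pos_lower_bound dx0.
have [cu cu0 Hcu] := exists_pos_lower_bound du0.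
pose c := Num.min cx cu; have c0 : 0 < c by rewrite lt_min cx0.
have {}Hcx i : c <= dx i 0 by rewrite ge_min Hcx.
have {}Hcu j : c <= du j 0 by rewrite ge_min Hcu orbT.
(* The cap 1 serves the [1 / delta] scale; [eta * c / 2] keeps [delta] strictly below every slack
   [eta * d_i]; the exponential gives [ln (d_i / delta) >= (b + 1) / eps]. *)
pose delta0 := Num.min 1 (Num.min (eta * c / 2) (c * expR (- ((b + 1) / eps)))).
have delta00 : 0 < delta0.
  by rewrite !lt_min ltr01 divr_gt0 ?mulr_gt0 ?expR_gt0.
(* Chosen so that [L * kappa ^+ 2 <= 1]: the initialization error then raises the cost by at most
   1. *)
pose kappa := (1 + L)^-1.
have L1 : 0 < 1 + L by rewrite ltr_pwDl.
have kappa0 : 0 < kappa by rewrite invr_gt0.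
exists delta0, (fun r => kappa * r); split=> //; split.
  split.
  - apply: continuous_subspaceT => r; apply: cvgMr; exact: cvg_id.
  - by move=> r s _ rs; rewrite ltr_pM2l.
  - by rewrite mulr0.
  - move=> M; exists (`|M| / kappa); split; first by rewrite divr_ge0 ?(ltW kappa0).
    by rewrite mulrC divfK ?ler_norm// gt_eqF.
move=> delta de0; rewrite !le_min => /and3P[de1 deeta deexp].
have ded y : c <= y -> delta < eta * y /\ delta <= y.
  move=> cy; have H : delta < eta * y.
    apply: (le_lt_trans deeta); rewrite ltr_pdivrMr// -mulrA ltr_pM2l//.
    lra.
  split=> //; apply: (le_trans (ltW H)).
  by rewrite ler_piMl// (le_trans (ltW c0)).
have dedx i : delta <= dx i 0 by have [] := ded _ (Hcx i).
have dedu j : delta <= du j 0 by have [] := ded _ (Hcu j).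
have [pdP [DARE [_ [Hkf [Hpsio [gamma0 _]]]]]] := Hdelta delta de0 dedx dedu.
have {}HP := HP delta (P delta) de0 de1 pdP DARE.
move=> x0 X0x0 U0; set J := JN eps delta A B Q Rc Cx dx wx Cu du wu (P delta).
set Us := argmin _ => U0s iT.
(* [argmin] picks by [get], which returns a default value on an empty set; existence of a minimizer
   makes [Us] a genuine one. *)
have Usmin V : J Us x0 <= J V x0.
  have [W HW] := JN_minimizer (N := N) A B e0 wx0 wu0 psdQ pdR wCx wCu
    de0 dedx dedu pdP x0 cU.
  exact: (getPex (ex_intro (fun U => forall V, J U x0 <= J V x0) W HW)).
have JU0 : J U0 x0 <= b + 1.
  have [U JU] := Hfeas delta (P delta) de0 (fun i => (ded _ (Hcx i)).1)
    (fun j => (ded _ (Hcu j)).1) x0 X0x0.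
  have -> : U0 = Us + (U0 - Us) by rewrite addrC subrK.
  have := minimizer_perturbation Usmin
    (HL delta (P delta) de0 de1 HP x0 Us (U0 - Us)).
  move=> /le_trans; apply; apply: lerD.
    exact: le_trans (Usmin U) JU.
  have V0 : 0 <= `|U0 - Us| / delta by rewrite divr_ge0 ?(ltW de0).
  have Vk : `|U0 - Us| / delta <= kappa.
    by rewrite ler_pdivrMr// (le_trans (norm_le_enorm _)).
  have kL : kappa * (1 + L) = 1 by rewrite mulVf ?gt_eqF.
  have : (`|U0 - Us| / delta) ^+ 2 <= kappa ^+ 2 by rewrite ler_sqr ?nnegrE ?(ltW kappa0).
  move=> /(ler_wpM2l L0) /le_trans; apply.
  nra.
pose xU := closed_loop A B (kf delta) (Psio delta) iT x0 U0.
(* The shift lowers the cost by at least a nonnegative stage cost, and each optimizer iteration at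
   the successor state does not raise it, whatever the number [iT k] of iterations. *)
have Jdecr k : J (xU k).2 (xU k).1 <= b + 1.
  elim: k => [|k IH] //=.
  rewrite /xU/= -/(xU k); case: (xU k) IH => x U /= IH.
  have J0 : J (shiftU U (kf delta U x)) (A *m x + B *m getu U 0) <= b + 1.
    have l0 : 0 <= ell eps delta Q Rc Cx dx wx Cu du wu x (getu U 0).
      exact: ell_ge0.
    by have := Hkf U x; rewrite -/J; lra.
  elim: (iT k) => [|i IHi] //=.
  set V := Phi _ _ _ _ _ _ _ in IHi *.
  have := Hpsio V (A *m x + B *m getu U 0).
  have := gamma0 V (A *m x + B *m getu U 0).
  by rewrite -/J; lra.
(* A violated constraint would force the barrier at least 1/2 above [(b + 1) / eps], by the
   exponential cap in [delta0]. *)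
have noviol q p (C : 'M[R]_(q, p)) (d w : 'cV[R]_q) y :
    (forall i, 0 <= w i 0) -> (forall i, c <= d i 0) -> weight_cond C d w ->
    eps * recB delta C d w y <= b + 1 -> lev (C *m y) d.
  move=> w0 cd wC yb i; rewrite leNgt; apply/negP => viol.
  have := recB_violation w0 de0 (fun i => (ded _ (cd i)).2) wC viol.
  have : recB delta C d w y <= (b + 1) / eps by rewrite ler_pdivlMr// mulrC.
  have : 0 < ((C *m y) i 0 - d i 0) / delta by rewrite divr_gt0// subr_gt0.
  have : ln delta <= ln (c * expR (- ((b + 1) / eps))).
    by rewrite ler_ln ?posrE// mulr_gt0// expR_gt0.
  rewrite lnM ?posrE ?expR_gt0// expRK.
  have : ln c <= ln (d i 0) by rewrite ler_ln ?posrE// (lt_le_trans c0).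
  lra.
have tolD q (z y d : 'cV[R]_q) : (forall i, 0 <= z i 0) -> lev y d -> lev y (d + z).
  by move=> z0 yd i; rewrite mxE (le_trans (yd i))// lerDl.
move=> k; rewrite -/(xU k) /=.
(* The current state and the applied input form stage 0 of the prediction, a summand of the cost
   because [N] is positive. *)
have lb : ell eps delta Q Rc Cx dx wx Cu du wu (xU k).1 (getu (xU k).2 0) <= b + 1.
  apply: le_trans (Jdecr k).
  exact: (JN_ge_ell A B e0 wx0 wu0 psdQ pdR wCx wCu de0 dedx dedu pdP
    (xU k).2 (xU k).1 N0).
split; apply: tolD => //; apply: noviol => //; apply: le_trans lb.
  exact: ell_ge_recBx.
exact: ell_ge_recBu.
Qed.
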